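(* Let $U$ be a singular $n\times n$ upper triangular complex pencil with a zero diagonal element in the $(k+1,k+1)$ entry. Then, for every $\epsilon>0$, there exists a singular $n\times n$ upper triangular complex pencil $T$ satisfying the following properties: (i) $T$ has normal rank $n-1$; (ii) $T$ has no eigenvalues (finite or infinite); (iii) $T$ has exactly one zero diagonal element, located in the $(k+1,k+1)$ entry; (iv) the unique right minimal index of $T$ is equal to $k$; (v) $\|T-U\|_F\le\epsilon$ (that is, $T$ can be chosen arbitrarily close to $U$).
   Context: An $n\times n$ complex pencil is $A+\lambda B$ with $A,B\in\mathbb{C}^{n\times n}$; it is singular if $\det(A+\lambda B)\equiv 0$. Its norm is $\|A+\lambda B\|_F=(\|A\|_F^2+\|B\|_F^2)^{1/2}$, with the Frobenius norm on the right. Its normal rank is its rank over the field $\mathbb{C}(\lambda)$. An element $\mu\in\mathbb{C}\cup\{\infty\}$ is an eigenvalue of $A+\lambda B$ if $\operatorname{rank}(A+\mu B)$ is strictly smaller than the normal rank, with the convention $A+\infty B:=B$. If the pencil has normal rank $n-1$, its right null space over $\mathbb{C}(\lambda)$ is one-dimensional, and its unique right minimal index is the smallest degree among the nonzero polynomial vectors in this null space. *)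

(* Defs.v *)
(* The field of complex numbers is R[i] for R : realType. *)
From mathcomp Require Import all_boot all_order all_algebra.
From mathcomp Require Import complex reals.

Set Implicit Arguments.
Unset Strict Implicit.
Unset Printing Implicit Defensive.

Import Order.TTheory GRing.Theory Num.Theory.
Local Open Scope ring_scope.

(* The pair (A, B) stands for A + lambda B; pairs carry the componentwise
   additive group structure, so that T - U is the difference of pencils. *)
Definition pencil (F : fieldType) (n : nat) : Type := ('M[F]_n * 'M[F]_n)%type.

Section Pencil.

Variables (F : fieldType) (n : nat).
Implicit Types P : pencil F n.

(* A + lambda B as a matrix over F[lambda] and over F(lambda). *)
Definition pencil_mx P : 'M[{poly F}]_n :=
  map_mx polyC P.1 + 'X *: map_mx polyC P.2.

Definition pencil_fmx P : 'M[{fraction {poly F}}]_n :=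
  map_mx (@tofrac {poly F}) (pencil_mx P).

Definition pencil_singular P : Prop := \det (pencil_mx P) = 0.

Definition pencil_upper_triangular P : Prop :=
  forall i j : 'I_n, (j < i)%N -> pencil_mx P i j = 0.

Definition normal_rank P : nat := \rank (pencil_fmx P).

(* None is the point at infinity: A + oo B := B. *)
Definition pencil_eval P (mu : option F) : 'M[F]_n :=
  if mu is Some a then P.1 + a *: P.2 else P.2.

Definition pencil_eigenvalue P (mu : option F) : Prop :=
  (\rank (pencil_eval P mu) < normal_rank P)%N.

(* (size p).-1 is the degree of p <> 0, and 0 for p = 0; hence this is the
   usual degree of v whenever v <> 0. *)
Definition polyvec_degree (v : 'cV[{poly F}]_n) : nat :=
  \max_(i < n) (size (v i ord0)).-1.

Definition in_right_null P (v : 'cV[{poly F}]_n) : Prop :=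
  pencil_fmx P *m map_mx (@tofrac {poly F}) v = 0.

(* Only meaningful as "the" right minimal index when P has normal rank n - 1,
   i.e. when its right null space over F(lambda) is a line. *)
Definition is_right_minimal_index P (d : nat) : Prop :=
  (exists v, [/\ v != 0, in_right_null P v & polyvec_degree v = d]) /\
  (forall v, v != 0 -> in_right_null P v -> (d <= polyvec_degree v)%N).

End Pencil.

Section Norm.

Variables (R : realType) (n : nat).

Definition frobenius_norm (A : 'M[R[i]]_n) : R :=
  Num.sqrt (\sum_(i < n) \sum_(j < n) ComplexField.Normc.normc (A i j) ^+ 2).

Definition pencil_norm (P : pencil R[i] n) : R :=
  Num.sqrt (frobenius_norm P.1 ^+ 2 + frobenius_norm P.2 ^+ 2).

End Norm.

(* Main.v *)
Require Import Defs.
From mathcomp Require Import all_boot all_order all_algebra.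
From mathcomp Require Import complex reals ring lra.

Set Implicit Arguments.
Unset Strict Implicit.
Unset Printing Implicit Defensive.

Import Order.TTheory GRing.Theory Num.Theory.
Local Open Scope ring_scope.

(** Why the theorem holds. Write an upper triangular pencil with a zero at
    (k, k) (indices start at 0) as
<<
        [ T11  c   *  ]
        [  0   0   r  ]
        [  0   0  T33 ]
>>
    with T11 of size k. If the k x (k+1) pencil [T11 c] has full row rank and
    [r; T33] has full column rank at every point of the projective line, then
    the whole pencil has rank n - 1 everywhere, so its normal rank is n - 1 and
    it has no eigenvalues. A null vector vanishes below position k, hence its
    upper part is a null vector of [T11 c], of degree k by the count below.

    Suppose that every diagonal entry a_i + lambda b_i (i <> k) has b_i <> 0 and
    that the roots mu_i = - a_i / b_i are distinct ([separated_trig]). Away from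
    the mu_i, and at infinity, the only zero on the diagonal is at k and the rank
    is clearly n - 1. At mu_i with i < k, the block T11(mu_i) is singular with a
    left null vector w, and full rank of [T11 c](mu_i) amounts to
    w c(mu_i) <> 0 ([coupled_above]); symmetrically, for i > k, a right null
    vector z of T33(mu_i) has to satisfy r(mu_i) z <> 0 ([coupled_below]). A
    pencil with these properties is called [generic_trig], and [gt_rank_eval] is
    the resulting lower bound on the rank.

    The same vectors w give the lower bound on the minimal index
    ([gt_null_degree_ge]): if T v = 0, then multiplying T(mu_i) v(mu_i) = 0 by w
    leaves (w c(mu_i)) v_k(mu_i) = 0, so v_k vanishes at k distinct points; and
    v_k <> 0, as otherwise back substitution gives v = 0. The upper bound
    ([st_null_degree_leq]) comes from the maximal minors of [T11 c], which form a
    null vector and have degree at most k.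

    A pencil becomes generic after two perturbations. Adding
    t (1 / (i+1) + lambda) to the diagonal entries with i <> k separates the roots
    for all but finitely many t, because the condition mu_i = mu_j becomes a
    quadratic equation in t with leading coefficient 1 / (i+1) - 1 / (j+1)
    ([shift_diag_separated]). Next, adding s, s^2, s^3, ... to the constant terms
    of c and r changes neither the diagonal nor the vectors w and z, whereas
    w c(mu_i) and r(mu_i) z become polynomials in s having the entries of w or z
    among their coefficients, hence nonzero ([shift_cross_generic]). Thus t and s
    can be taken real, positive and as small as desired. *)

(** * Upper triangular matrices *)

Definition upper_trig (D : idomainType) n (M : 'M[D]_n) :=
  forall i j : 'I_n, (j < i)%N -> M i j = 0.

Lemma det_upper_trig (D : idomainType) n (M : 'M[D]_n) :
  upper_trig M -> \det M = \prod_(i < n) M i i.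
Proof.
move=> utM; rewrite -det_tr det_trig; first by apply: eq_bigr => i _; rewrite mxE.
by apply/is_trig_mxP => i j ltij; rewrite mxE utM.
Qed.

(** Solving [M x = 0] upwards from row [b] to row [a] only divides by the diagonal
    entries met on the way, so zeros elsewhere on the diagonal are harmless. *)
Lemma back_substitution (D : idomainType) n (M : 'M[D]_n) (x : 'cV[D]_n)
    (a b : nat) :
    upper_trig M ->
    (forall i : 'I_n, (a <= i < b)%N -> M i i != 0) ->
    (forall i : 'I_n, (a <= i < b)%N -> (M *m x) i ord0 = 0) ->
    (forall i : 'I_n, (b <= i)%N -> x i ord0 = 0) ->
  forall i : 'I_n, (a <= i)%N -> x i ord0 = 0.
Proof.
move=> utM Md Mx xb.
suff xm : forall m (i : 'I_n), (n - i <= m)%N -> (a <= i)%N -> x i ord0 = 0.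
  by move=> i; apply: (xm (n - i)%N).
elim=> [|m IHm] i; first by rewrite leqn0 subn_eq0 leqNgt ltn_ord.
move=> le_m ai; case: (leqP b i) => [/xb //|ib].
have iab : (a <= i < b)%N by rewrite ai.
have := Mx i iab; rewrite mxE (bigD1 i) //= big1 ?addr0.
  by move/eqP; rewrite mulf_eq0 (negPf (Md i iab)) => /eqP.
move=> j nji; case: (ltngtP i j) => [ij|ji|/val_inj eij].
- rewrite IHm ?mulr0 ?(leq_trans ai (ltnW ij)) //.
  by rewrite -ltnS (leq_trans _ le_m) // ltn_sub2l.
- by rewrite utM ?mul0r.
- by rewrite eij eqxx in nji.
Qed.

(** The principal submatrix of [M] on the index set [S], padded with an identity
    block so that no change of dimension is needed. *)
Definition principal (D : idomainType) n (S : pred 'I_n) (M : 'M[D]_n) : 'M[D]_n :=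
  \matrix_(i, j) if S i && S j then M i j else (i == j)%:R.

Lemma principal_upper_trig (D : idomainType) n (S : pred 'I_n) (M : 'M[D]_n) :
  upper_trig M -> upper_trig (principal S M).
Proof.
by move=> utM i j ji; rewrite mxE utM // -val_eqE gtn_eqF //; case: ifP.
Qed.

Lemma det_principal0 (D : idomainType) n (S : pred 'I_n) (M : 'M[D]_n) i :
  upper_trig M -> S i -> M i i = 0 -> \det (principal S M) = 0.
Proof.
move=> utM Si Mi; rewrite det_upper_trig; last exact: principal_upper_trig.
by rewrite (bigD1 i) //= mxE Si Mi mul0r.
Qed.

(** The padding rows force [x] to vanish off [S], and then the rows in [S] of [M]
    and of the padded submatrix give the same equations. *)
Lemma principal_mul_col (D : idomainType) n (S : pred 'I_n) (M : 'M[D]_n)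
    (x : 'cV[D]_n) :
    principal S M *m x = 0 ->
  (forall i, ~~ S i -> x i ord0 = 0) /\ (forall i, S i -> (M *m x) i ord0 = 0).
Proof.
move=> Px.
have xS i : ~~ S i -> x i ord0 = 0.
  move=> nSi; have /colP/(_ i) := Px; rewrite !mxE (bigD1 i) //= big1 => [|j nji].
    by rewrite mxE (negPf nSi) eqxx mul1r addr0.
  by rewrite mxE (negPf nSi) eq_sym (negPf nji) mul0r.
split=> // i Si; have /colP/(_ i) := Px; rewrite [in RHS]mxE => <-; rewrite !mxE.
apply: eq_bigr => j _; rewrite mxE Si /=.
by case: ifPn => // /xS ->; rewrite !mulr0.
Qed.

Lemma principal_kernel_row (D : idomainType) n (S : pred 'I_n) (M : 'M[D]_n) i :
    upper_trig M -> S i -> M i i = 0 ->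
  exists2 w : 'rV[D]_n, w != 0 &
    (forall j, ~~ S j -> w ord0 j = 0) /\ (forall j, S j -> (w *m M) ord0 j = 0).
Proof.
move=> utM Si Mi.
have /eqP/det0P [w w0 wP] := det_principal0 utM Si Mi.
(* The row version is the column version for the transpose. *)
have tP : (principal S M)^T = principal S M^T.
  by apply/matrixP => a b; rewrite !mxE andbC eq_sym.
have [wS wM] : (forall j, ~~ S j -> w^T j ord0 = 0)
             /\ (forall j, S j -> (M^T *m w^T) j ord0 = 0).
  by apply: principal_mul_col; rewrite -tP -trmx_mul wP trmx0.
exists w; [exact: w0 | split=> j Sj; last first].
  by rewrite -(wM j Sj) -trmx_mul [RHS]mxE.
by rewrite -(wS j Sj) mxE.
Qed.

Lemma principal_kernel_col (D : idomainType) n (S : pred 'I_n) (M : 'M[D]_n) i :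
    upper_trig M -> S i -> M i i = 0 ->
  exists2 z : 'cV[D]_n, z != 0 &
    (forall j, ~~ S j -> z j ord0 = 0) /\ (forall j, S j -> (M *m z) j ord0 = 0).
Proof.
move=> utM Si Mi.
have := det_principal0 utM Si Mi; rewrite -det_tr => /eqP/det0P [w w0 wP].
exists w^T; first by rewrite -trmx0 (inj_eq trmx_inj).
by apply: principal_mul_col; rewrite -[_ *m _]trmxK trmx_mul trmxK wP trmx0.
Qed.

(** * Matrices whose kernel is at most a line *)

(** If the coordinate [p] is injective on the kernel, the kernel is at most a
    line. *)
Lemma rank_ge_predn (F : fieldType) n (M : 'M[F]_n) (p : 'I_n) :
    (forall x : 'cV[F]_n, M *m x = 0 -> x p ord0 = 0 -> x = 0) ->
  (n.-1 <= \rank M)%N.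
Proof.
move=> kerM; pose K := kermx M^T; pose e : 'M[F]_(n, 1) := delta_mx p ord0.
have : (K :&: kermx e)%MS = 0.
  apply/eqP/rowV0P => v; rewrite sub_capmx => /andP[/sub_kermxP vM /sub_kermxP ve].
  have : v^T = 0.
    apply: kerM; first by rewrite -[M]trmxK -trmx_mul vM trmx0.
    by move/matrixP/(_ ord0 ord0): ve; rewrite -[e]/(delta_mx _ _) -colE !mxE.
  by move/(congr1 trmx); rewrite trmxK trmx0.
move=> Ke; have := mxrank_mul_ker K e; rewrite Ke mxrank0 addn0 mxrank_ker mxrank_tr.
move=> eqr; have := rank_leq_col (K *m e); rewrite eqr leq_subLR addn1 => le_n.
by rewrite -subn1 leq_subLR add1n.
Qed.

Section KernelLine.

Variables (F : fieldType) (n : nat) (k : 'I_n) (M : 'M[F]_n).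
Hypotheses (utM : upper_trig M) (Mk : M k k = 0).

Lemma rank_one_zero_diag :
  (forall i, i != k -> M i i != 0) -> (n.-1 <= \rank M)%N.
Proof.
move=> Md; apply: (@rank_ge_predn _ _ _ k) => x Mx xk.
have nk (i : 'I_n) : (i < k)%N || (k < i)%N -> i != k by rewrite -neq_ltn.
have x_ge : forall j : 'I_n, (k <= j)%N -> x j ord0 = 0.
  move=> j; rewrite leq_eqVlt => /orP[/eqP/val_inj <- //|].
  apply: (@back_substitution _ _ M x k.+1 n) => // [i /andP[ki _]|i _|i].
  - by rewrite Md // nk // ki orbT.
  - by rewrite Mx mxE.
  - by rewrite leqNgt ltn_ord.
apply/colP => j; rewrite [RHS]mxE.
apply: (@back_substitution _ _ M x 0 k) => // [i /andP[_ ik]|i _].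
  by rewrite Md // nk // ik.
by rewrite Mx mxE.
Qed.

(** With zeros at [p < k] on the diagonal, a null vector could a priori be chosen
    freely at both positions. Its entries past [k] vanish by back substitution, and
    pairing the equations of the rows above [k] with [w] eliminates the entries
    before [k], so that the entry at [k] vanishes as well. *)
Lemma rank_zero_diag_above (p : 'I_n) (w : 'rV[F]_n) :
    (p < k)%N -> (forall i, i != k -> i != p -> M i i != 0) ->
    (forall j : 'I_n, (k <= j)%N -> w ord0 j = 0) ->
    (forall j : 'I_n, (j < k)%N -> (w *m M) ord0 j = 0) ->
    (w *m M) ord0 k != 0 ->
  (n.-1 <= \rank M)%N.
Proof.
move=> pk Md w0 wM wMk; apply: (@rank_ge_predn _ _ _ p) => x Mx xp.
have Mx0 i : (M *m x) i ord0 = 0 by rewrite Mx mxE.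
have x_gt : forall j : 'I_n, (k < j)%N -> x j ord0 = 0.
  apply: (@back_substitution _ _ M x k.+1 n) => // [i /andP[ki _]|i].
    by rewrite Md // -val_eqE gtn_eqF // (ltn_trans pk).
  by rewrite leqNgt ltn_ord.
have xk : x k ord0 = 0.
  have : (w *m M *m x) ord0 ord0 = 0 by rewrite -mulmxA Mx mulmx0 mxE.
  rewrite mxE (bigD1 k) //= big1 ?addr0 => [/eqP|j njk].
    by rewrite mulf_eq0 (negPf wMk) => /eqP.
  case: (ltngtP j k) => [/wM -> |/x_gt -> |/val_inj jk]; rewrite ?mul0r ?mulr0 //.
  by rewrite jk eqxx in njk.
have x_ge : forall j : 'I_n, (p < j)%N -> x j ord0 = 0.
  apply: (@back_substitution _ _ M x p.+1 k) => // [i /andP[pi ik]|i].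
    by apply: Md; rewrite neq_ltn ?ik ?pi ?orbT.
  by rewrite leq_eqVlt => /orP[/eqP/val_inj <- //|/x_gt].
apply/colP => j; rewrite [RHS]mxE.
apply: (@back_substitution _ _ M x 0 p) => // [i /andP[_ ip]|i].
  by rewrite Md // -val_eqE ltn_eqF // (ltn_trans ip).
by rewrite leq_eqVlt => /orP[/eqP/val_inj <- //|/x_ge].
Qed.

(** With zeros at [k < p] on the diagonal, the entries of a null vector past [k]
    are proportional to [z], and row [k] rules out a nonzero multiple. *)
Lemma rank_zero_diag_below (p : 'I_n) (z : 'cV[F]_n) :
    (k < p)%N -> (forall i, i != k -> i != p -> M i i != 0) ->
    (forall j : 'I_n, (j <= k)%N -> z j ord0 = 0) ->
    (forall j : 'I_n, (k < j)%N -> (M *m z) j ord0 = 0) ->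
    (M *m z) k ord0 != 0 ->
  (n.-1 <= \rank M)%N.
Proof.
move=> kp Md z0 Mz Mzk; apply: (@rank_ge_predn _ _ _ k) => x Mx xk.
have Mx0 i : (M *m x) i ord0 = 0 by rewrite Mx mxE.
have past_p (y : 'cV_n) : (forall j : 'I_n, (k < j)%N -> (M *m y) j ord0 = 0) ->
    forall j : 'I_n, (p < j)%N -> y j ord0 = 0.
  move=> My; apply: (@back_substitution _ _ M y p.+1 n) => //.
  - by move=> i /andP[pi _]; rewrite Md // -val_eqE gtn_eqF // (ltn_trans kp).
  - by move=> i /andP[pi _]; rewrite My // (ltn_trans kp).
  - by move=> i; rewrite leqNgt ltn_ord.
have past_k (y : 'cV_n) : (forall j : 'I_n, (k < j)%N -> (M *m y) j ord0 = 0) ->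
    y p ord0 = 0 -> forall j : 'I_n, (k < j)%N -> y j ord0 = 0.
  move=> My yp; apply: (@back_substitution _ _ M y k.+1 p) => //.
  - by move=> i /andP[ki ip]; apply: Md; rewrite neq_ltn ?ip ?ki ?orbT.
  - by move=> i /andP[ki _]; rewrite My.
  - by move=> i; rewrite leq_eqVlt => /orP[/eqP/val_inj <- //|/(past_p y My)].
have row_k (y : 'cV_n) : (forall j : 'I_n, (k < j)%N -> y j ord0 = 0) ->
    (M *m y) k ord0 = 0.
  move=> yk; rewrite mxE big1 // => j _.
  case: (ltngtP j k) => [/utM -> |/yk -> |/val_inj ->].
  - by rewrite mul0r.
  - by rewrite mulr0.
  - by rewrite Mk mul0r.
have zp : z p ord0 != 0.
  by apply: contraNneq Mzk => zp; rewrite row_k //; apply: past_k.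
have xp : x p ord0 = 0.
  pose c := x p ord0 / z p ord0; pose y := x - c *: z.
  have My j : (M *m y) j ord0 = - (c * (M *m z) j ord0).
    by rewrite mulmxBr -scalemxAr Mx sub0r !mxE.
  have : (M *m y) k ord0 = 0.
    apply/row_k/past_k; first by move=> j kj; rewrite My Mz // mulr0 oppr0.
    by rewrite !mxE divfK // subrr.
  rewrite My => /eqP; rewrite oppr_eq0 !mulf_eq0 (negPf Mzk) orbF invr_eq0.
  by rewrite (negPf zp) orbF => /eqP.
apply/colP => j; rewrite [RHS]mxE.
apply: (@back_substitution _ _ M x 0 k) => // [i /andP[_ ik]|i].
  by rewrite Md // -val_eqE ltn_eqF // (ltn_trans ik).
rewrite leq_eqVlt => /orP[/eqP/val_inj <- //|]; exact: past_k.
Qed.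

End KernelLine.

(** * Degrees of determinants of polynomial matrices *)

(** Each term of the Leibniz expansion takes exactly one entry from every row. *)
Lemma size_det_leq (D : idomainType) m (d : 'I_m -> nat) (M : 'M[{poly D}]_m) :
    (forall i j, size (M i j) <= (d i).+1)%N ->
  (size (\det M) <= (\sum_(i < m) d i).+1)%N.
Proof.
move=> Md; apply: (leq_trans (size_sum _ _ _)); apply/bigmax_leqP => s _.
rewrite mulr_sign (fun_if (fun q : {poly D} => size q)) size_polyN if_same.
elim/big_rec2: _ => [|i e q _ le_q]; first by rewrite size_poly1.
apply: (leq_trans (size_polyMleq _ _)).
by rewrite -subn1 leq_subLR add1n -addSn -addnS leq_add.
Qed.

(** The total row degree of a matrix whose rows of index less than [k] are linear
    and whose other rows are constant. *)
Lemma sum_ltn_leq m k : (\sum_(i < m) (i < k) <= k)%N.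
Proof.
suff -> : (\sum_(i < m) (i < k))%N = minn m k by exact: geq_minr.
elim: m => [|m IHm]; first by rewrite big_ord0 min0n.
rewrite big_ord_recr /= IHm; have [mk|km] := boolP (m < k)%N.
  by rewrite (minn_idPl mk) (minn_idPl (ltnW mk)) addn1.
rewrite -leqNgt in km.
by rewrite (minn_idPr km) (minn_idPr (leqW km)) addn0.
Qed.

(** * Pencils as polynomial matrices *)

Section PencilEntries.

Variables (F : fieldType) (n : nat) (T : pencil F n).

Lemma pencil_mxE i j :
  pencil_mx T i j = (T.1 i j)%:P + 'X * (T.2 i j)%:P.
Proof. by rewrite !mxE. Qed.

Lemma pencil_mx_eq0 i j : pencil_mx T i j = 0 <-> T.1 i j = 0 /\ T.2 i j = 0.
Proof.
rewrite pencil_mxE; split=> [T0 | [-> ->]]; last by rewrite mulr0 addr0.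
split.
  by move/(congr1 (coefp 0)): T0; rewrite /= coefD coefC coefXM coef0 addr0.
by move/(congr1 (coefp 1)): T0; rewrite /= coefD coefC coefXM coefC coef0 add0r.
Qed.

Lemma size_pencil_mx i j : (size (pencil_mx T i j) <= 2)%N.
Proof.
rewrite pencil_mxE (leq_trans (size_polyD _ _)) // geq_max.
rewrite (leq_trans (size_polyC_leq1 _)) //=.
rewrite mulrC (leq_trans (size_polyMleq _ _)) //.
by rewrite size_polyX addn2 /= ltnS size_polyC_leq1.
Qed.

(** Lets identities between polynomial matrices be evaluated at a point. *)
Lemma pencil_eval_horner mu :
  pencil_eval T (Some mu) = map_mx (horner_eval mu) (pencil_mx T).
Proof. by apply/matrixP => i j; rewrite !mxE /horner_eval !hornerE. Qed.

Lemma in_right_nullE (v : 'cV[{poly F}]_n) :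
  in_right_null T v <-> pencil_mx T *m v = 0.
Proof.
rewrite /in_right_null /pencil_fmx -map_mxM; split=> [|->]; last exact: map_mx0.
move=> /matrixP Tv0; apply/matrixP => i j; have := Tv0 i j; rewrite 2!mxE [RHS]mxE.
by move/eqP; rewrite tofrac_eq0 => /eqP ->; rewrite mxE.
Qed.

End PencilEntries.

(** * A generic upper triangular pencil with one zero on its diagonal *)

Definition diag_root (F : fieldType) n (T : pencil F n) (i : 'I_n) : F :=
  - T.1 i i / T.2 i i.

(** When the leading block of [M] of size [k] has corank 1, this says that column
    [k] restores its full row rank: the part of column [k] above the diagonal is
    not orthogonal to a left null vector [w] of the block. *)
Definition coupled_above (F : fieldType) n (k : 'I_n) (M : 'M[F]_n) :=
  exists w : 'rV[F]_n,
    [/\ forall j : 'I_n, (k <= j)%N -> w ord0 j = 0,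
        forall j : 'I_n, (j < k)%N -> (w *m M) ord0 j = 0
      & (w *m M) ord0 k != 0].

(** The mirror image of [coupled_above], for the trailing block past [k] and the
    part of row [k] to the right of the diagonal. *)
Definition coupled_below (F : fieldType) n (k : 'I_n) (M : 'M[F]_n) :=
  exists z : 'cV[F]_n,
    [/\ forall j : 'I_n, (j <= k)%N -> z j ord0 = 0,
        forall j : 'I_n, (k < j)%N -> (M *m z) j ord0 = 0
      & (M *m z) k ord0 != 0].

Record separated_trig (F : fieldType) n (k : 'I_n) (T : pencil F n) : Prop := {
  st_upper1 : upper_trig T.1;
  st_upper2 : upper_trig T.2;
  st_k1 : T.1 k k = 0;
  st_k2 : T.2 k k = 0;
  st_diag : forall i, i != k -> T.2 i i != 0;
  st_root : forall i j, i != k -> j != k -> i != j ->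
    diag_root T i != diag_root T j
}.

Record generic_trig (F : fieldType) n (k : 'I_n) (T : pencil F n) : Prop := {
  gt_separated :> separated_trig k T;
  gt_above : forall i : 'I_n, (i < k)%N ->
    coupled_above k (pencil_eval T (Some (diag_root T i)));
  gt_below : forall i : 'I_n, (k < i)%N ->
    coupled_below k (pencil_eval T (Some (diag_root T i)))
}.

Section SeparatedTrig.

Variables (F : fieldType) (n : nat) (k : 'I_n) (T : pencil F n).
Hypothesis gT : separated_trig k T.

Lemma st_pencil_upper : upper_trig (pencil_mx T).
Proof.
by move=> i j ji; apply/pencil_mx_eq0; rewrite (st_upper1 gT) // (st_upper2 gT).
Qed.

Lemma st_pencil_diag i : pencil_mx T i i = 0 <-> i = k.
Proof.
rewrite pencil_mx_eq0; split=> [[_ /eqP]| ->].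
  by apply: contraTeq; apply: (st_diag gT).
by rewrite (st_k1 gT) (st_k2 gT).
Qed.

Lemma st_pencil_diagN i : i != k -> pencil_mx T i i != 0.
Proof. by apply: contra_neq => /st_pencil_diag. Qed.

Lemma st_eval_upper mu : upper_trig (pencil_eval T mu).
Proof.
case: mu => [mu|] i j ji /=; last exact: (st_upper2 gT).
by rewrite !mxE (st_upper1 gT) // (st_upper2 gT) // mulr0 addr0.
Qed.

Lemma st_eval_k mu : pencil_eval T mu k k = 0.
Proof.
case: mu => [mu|] /=; last exact: (st_k2 gT).
by rewrite !mxE (st_k1 gT) (st_k2 gT) mulr0 addr0.
Qed.

Lemma st_eval_diag_eq0 mu i : i != k ->
  (pencil_eval T (Some mu) i i == 0) = (mu == diag_root T i).
Proof.
move=> /(st_diag gT) Ti; rewrite /diag_root !mxE -[in RHS](can_eq (mulfK Ti)) divfK //.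
by rewrite addrC addr_eq0.
Qed.

Lemma st_singular : pencil_singular T.
Proof.
rewrite /pencil_singular (det_upper_trig st_pencil_upper) (bigD1 k) //=.
by rewrite (st_pencil_diag k).2 // mul0r.
Qed.

Lemma st_normal_rank : normal_rank T = n.-1.
Proof.
have utT : upper_trig (pencil_fmx T).
  by move=> i j ji; rewrite mxE st_pencil_upper // tofrac0.
apply/eqP; rewrite eqn_leq (@rank_one_zero_diag _ _ k) // ?andbT; last first.
  by move=> i ik; rewrite mxE tofrac_eq0 st_pencil_diagN.
have n0 : (0 < n)%N := leq_ltn_trans (leq0n k) (ltn_ord k).
rewrite -ltnS prednK // ltn_neqAle rank_leq_row andbT.
rewrite -[_ == _]/(row_free _) row_free_unit unitmxE unitfE.
by rewrite det_map_mx st_singular rmorph0 eqxx.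
Qed.

(** The null vector consists of the signed maximal minors of the first [k]
    rows and [k+1] columns, read off as a column of the adjugate of the padded
    leading block of size [k+1], whose determinant is zero because of the zero at
    [k]. The minors delete row [k], so that only [k] linear rows remain. *)
Lemma st_null_degree_leq :
  exists v, [/\ v != 0, pencil_mx T *m v = 0 & (polyvec_degree v <= k)%N].
Proof.
pose S : pred 'I_n := fun i => (i <= k)%N.
pose P := principal S (pencil_mx T); pose v := col k (\adj P).
have utT := st_pencil_upper; have Tk := (st_pencil_diag k).2 erefl.
have Pv : P *m v = 0.
  rewrite /v colE mulmxA mul_mx_adj /P (det_principal0 utT (leqnn k) Tk).
  by rewrite raddf0 mul0mx.
have [v_gt Tv_le] := principal_mul_col Pv.
exists v; split.
(* The minor at [k] is the product of the first [k] diagonal entries. *)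
- apply: contra_neq (_ : cofactor P k k != 0) => [/colP/(_ k)|].
    by rewrite !mxE.
  rewrite /cofactor mulf_eq0 signr_eq0 /= det_upper_trig; last first.
    move=> i j ji; rewrite 3!mxE utT; last by rewrite ltnNge leq_bump2 -ltnNge.
    by rewrite (inj_eq (@lift_inj _ k)) -val_eqE gtn_eqF //; case: ifP.
  apply/prodf_neq0 => i _; rewrite 3!mxE.
  case: ifP => _; last by rewrite eqxx oner_neq0.
  by rewrite st_pencil_diagN // eq_sym neq_lift.
- apply/colP => i; rewrite [RHS]mxE.
  case: (leqP i k) => [/Tv_le //|ki]; rewrite mxE big1 // => j _.
  case: (ltnP k j) => [kj|jk]; first by rewrite v_gt ?mulr0 // /S -ltnNge.
  by rewrite utT ?mul0r // (leq_ltn_trans jk).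
- apply/bigmax_leqP => l _; rewrite 2!mxE /cofactor.
  rewrite -signr_odd mulr_sign (fun_if (fun q : {poly F} => size q)) size_polyN if_same.
  rewrite -subn1 leq_subLR add1n.
  apply: (leq_trans (size_det_leq (d := fun i => (i < k)%N : nat) _)).
    have size_nat (b : bool) : (size (b%:R : {poly F}) <= 1)%N.
      by case: b; rewrite ?size_poly1 ?size_poly0.
    move=> i j; rewrite 3!mxE; case: (ltnP i k) => [ik|ki].
      by case: ifP => _; [apply: size_pencil_mx | apply: leqW].
    by rewrite /S /= /bump ki add1n ltnNge ki /=.
  by rewrite ltnS sum_ltn_leq.
Qed.

End SeparatedTrig.

Section GenericTrig.

Variables (F : fieldType) (n : nat) (k : 'I_n) (T : pencil F n).
Hypothesis gT : generic_trig k T.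

(** Since the diagonal roots are distinct, each evaluation has at most one further
    zero on its diagonal besides the one at [k]. *)
Lemma gt_rank_eval mu : (n.-1 <= \rank (pencil_eval T mu))%N.
Proof.
have := @rank_one_zero_diag _ _ k _ ((st_eval_upper gT) mu).
case: mu => [mu|]; last by apply=> i; apply: (st_diag gT).
case: (pickP (fun i => (i != k) && (mu == diag_root T i))) => [i | no_i]; last first.
  move=> rT; apply: rT => i ik; rewrite (st_eval_diag_eq0 gT) //.
  by have := no_i i; rewrite ik => /= ->.
case/andP=> ik /eqP mui _.
have Md j : j != k -> j != i -> pencil_eval T (Some mu) j j != 0.
  by move=> jk ji; rewrite (st_eval_diag_eq0 gT) // mui (st_root gT) // eq_sym.
case: (ltngtP i k) => [lik|lki|/val_inj eik]; last by rewrite eik eqxx in ik.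
  have [w [w0 wM wMk]] := gt_above gT lik; rewrite -mui in wM wMk.
  refine (rank_zero_diag_above (st_eval_upper gT _) lik Md w0 wM wMk).
have [z [z0 Mz Mzk]] := gt_below gT lki; rewrite -mui in Mz Mzk.
refine (rank_zero_diag_below (st_eval_upper gT _) (st_eval_k gT _) lki Md z0 Mz _).
exact: Mzk.
Qed.

Lemma gt_no_eigenvalue mu : ~ pencil_eigenvalue T mu.
Proof.
by rewrite /pencil_eigenvalue (st_normal_rank gT) ltnNge gt_rank_eval.
Qed.

(** The entry at [k] of a nonzero null vector is a nonzero polynomial that
    vanishes at the [k] distinct diagonal roots above it: at such a root, [w]
    annihilates every column before [k] but not column [k]. *)
Lemma gt_null_degree_ge (v : 'cV[{poly F}]_n) :
  v != 0 -> pencil_mx T *m v = 0 -> (k <= polyvec_degree v)%N.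
Proof.
move=> v0 Tv.
have v_gt : forall j : 'I_n, (k < j)%N -> v j ord0 = 0.
  apply: (@back_substitution _ _ (pencil_mx T) v k.+1 n).
  - exact: (st_pencil_upper gT).
  - by move=> i /andP[ki _]; rewrite (st_pencil_diagN gT) // neq_ltn ki orbT.
  - by move=> i _; rewrite Tv mxE.
  - by move=> i; rewrite leqNgt ltn_ord.
have vk : v k ord0 != 0.
  apply: contraNneq v0 => vk; apply/eqP/colP => j; rewrite [RHS]mxE.
  apply: (@back_substitution _ _ (pencil_mx T) v 0 k) => //.
  - exact: (st_pencil_upper gT).
  - by move=> i /andP[_ ik]; rewrite (st_pencil_diagN gT) // neq_ltn ik.
  - by move=> i _; rewrite Tv mxE.
  - by move=> i; rewrite leq_eqVlt => /orP[/eqP/val_inj <- //|/v_gt].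
have root_vk (i : 'I_n) : (i < k)%N -> root (v k ord0) (diag_root T i).
  move=> ik; have [w [_ wM wMk]] := gt_above gT ik.
  set mu := diag_root T i in wM wMk *; pose x := map_mx (horner_eval mu) v.
  have : (w *m pencil_eval T (Some mu) *m x) ord0 ord0 = 0.
    by rewrite -mulmxA pencil_eval_horner -map_mxM Tv map_mx0 mulmx0 mxE.
  rewrite mxE (bigD1 k) //= big1 ?addr0 => [/eqP|j njk].
    by rewrite mulf_eq0 (negPf wMk) mxE.
  case: (ltngtP j k) => [/wM -> |/v_gt vj|/val_inj jk].
  - by rewrite mul0r.
  - by rewrite [x j _]mxE vj /horner_eval horner0 mulr0.
  - by rewrite jk eqxx in njk.
have k_lt : (k < size (v k ord0))%N.
  pose below : 'I_k -> 'I_n := widen_ord (ltnW (ltn_ord k)).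
  have below_lt i : (below i < k)%N by exact: (ltn_ord i).
  have below_neq i : below i != k by rewrite neq_ltn below_lt.
  rewrite -[X in (X < _)%N]size_enum_ord -(size_map (diag_root T \o below)).
  apply: max_poly_roots => //.
    by apply/allP => _ /mapP[i _ ->]; apply: root_vk.
  rewrite map_inj_uniq ?enum_uniq // => i j eq_ij; apply/eqP.
  by apply: contra_eqT eq_ij => nij; apply: (st_root gT).
rewrite /polyvec_degree (leq_trans _ (leq_bigmax k)) //=.
by rewrite -ltnS prednK // (leq_ltn_trans _ k_lt).
Qed.

Lemma gt_right_minimal_index : is_right_minimal_index T k.
Proof.
split=> [|v v0 /in_right_nullE]; last exact: gt_null_degree_ge.
have [v [v0 Tv le_v]] := (st_null_degree_leq gT).
exists v; split=> //; first exact/in_right_nullE.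
by apply/eqP; rewrite eqn_leq le_v gt_null_degree_ge.
Qed.

End GenericTrig.

(** * Properties that hold outside the roots of a polynomial *)

(** Such properties are closed under finite conjunctions and hold at arbitrarily
    small positive real points. *)
Definition generically (F : fieldType) (P : F -> Prop) :=
  exists2 p : {poly F}, p != 0 & forall t, ~~ root p t -> P t.

Section Generically.

Variable F : fieldType.
Implicit Types P Q : F -> Prop.

Lemma generically_and P Q :
  generically P -> generically Q -> generically (fun t => P t /\ Q t).
Proof.
move=> [p p0 Pp] [q q0 Qq]; exists (p * q); first by rewrite mulf_neq0.
by move=> t; rewrite rootM negb_or => /andP[/Pp ? /Qq ?].
Qed.

Lemma generically_forall (I : finType) (P : I -> F -> Prop) :
  (forall i, generically (P i)) -> generically (fun t => forall i, P i t).
Proof.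
move=> /fin_all_exists2[p p0 Pp]; exists (\prod_i p i).
  by apply/prodf_neq0 => i _.
move=> t nrt i; apply: Pp; apply: contraNN nrt => rt.
by rewrite (bigD1 i) //= rootM rt.
Qed.

Lemma generically_imply (b : bool) P :
  (b -> generically P) -> generically (fun t => b -> P t).
Proof.
case: b => [/(_ isT) [p p0 Pp]|_]; first by exists p => // t /Pp.
by exists 1; rewrite ?oner_neq0.
Qed.

(** The powers start at 1, so that the constant [c] cannot cancel the
    coefficients [f]. *)
Lemma generically_sum_neq0 (m : nat) (c : F) (f : 'I_m -> F) (l : 'I_m) :
  f l != 0 -> generically (fun t => c + \sum_i f i * t ^+ i.+1 != 0).
Proof.
move=> fl; exists (c%:P + \sum_i f i *: 'X^(i.+1)).
  apply: contraNneq fl => /(congr1 (coefp l.+1)); rewrite /= coefD coefC add0r.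
  rewrite coef_sum coef0 (bigD1 l) //= big1 ?addr0 => [|i il].
    by rewrite coefZ coefXn eqxx mulr1 => ->.
  by rewrite coefZ coefXn eqSS val_eqE eq_sym (negPf il) mulr0.
move=> t; rewrite /root hornerD hornerC horner_sum.
by under eq_bigr => i _ do rewrite hornerZ hornerXn.
Qed.

End Generically.

Lemma generically_small (R : realType) (P : R[i] -> Prop) (e : R) :
  generically P -> 0 < e -> exists2 t : R, 0 < t <= e & P t%:C%C.
Proof.
(* There are more points [e / (m + 1)] with [m < size p] than roots of [p]. *)
move=> [p p0 Pp] e0; pose rs := [seq e / m.+1%:R | m <- iota 0 (size p)].
have rs_ok t : t \in rs -> 0 < t <= e.
  move=> /mapP[m _ ->]; rewrite divr_gt0 ?ltr0n //=.
  by rewrite ler_pdivrMr ?ltr0n // ler_peMr ?(ltW e0) // ler1n.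
have uniq_rs : uniq rs.
  rewrite map_inj_uniq ?iota_uniq // => a b /(mulfI (lt0r_neq0 e0))/invr_inj/eqP.
  by rewrite eqr_nat eqSS => /eqP.
have [/allP all_root|] := boolP (all (root p) [seq t%:C%C | t <- rs]).
  have : (size [seq t%:C%C | t <- rs] < size p)%N.
    apply: max_poly_roots => //; first exact/allP.
    by rewrite map_inj_uniq // => a b [].
  by rewrite !size_map size_iota ltnn.
by case/allPn => _ /mapP[t /rs_ok te ->] /Pp Pt; exists t.
Qed.

(** * The two perturbations *)

Section Perturbation.

Variables (F : numFieldType) (n : nat) (k : 'I_n).
Implicit Types T : pencil F n.

(** The factors 1 / (i+1) are distinct, which separates the diagonal roots, and at
    most 1, which bounds the size of the perturbation by [t]. *)
Definition shift_diag T (t : F) : pencil F n :=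
  (T.1 + \matrix_(i, j) (if (i == j) && (i != k) then t * i.+1%:R^-1 else 0),
   T.2 + \matrix_(i, j) (if (i == j) && (i != k) then t else 0)).

(** The distinct powers of [s] make the pairing with any nonzero vector a nonzero
    polynomial in [s]. *)
Definition shift_cross T (s : F) : pencil F n :=
  (T.1 + \matrix_(i, j) (if (j == k) && (i < k)%N then s ^+ i.+1 else
                         if (i == k) && (k < j)%N then s ^+ j.+1 else 0),
   T.2).

Lemma shift_diag_separated T :
    upper_trig T.1 -> upper_trig T.2 -> T.1 k k = 0 -> T.2 k k = 0 ->
  generically (fun t => separated_trig k (shift_diag T t)).
Proof.
move=> utA utB Ak Bk.
have gen_diag : generically (fun t => forall i, i != k -> T.2 i i + t != 0).
  apply: generically_forall => i; apply: generically_imply => _.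
  exists ('X + (T.2 i i)%:P); first by rewrite -size_poly_eq0 size_XaddC.
  by move=> t; rewrite /root !hornerE addrC.
pose crs i j t := (T.1 i i + t * i.+1%:R^-1) * (T.2 j j + t).
have gen_root : generically (fun t => forall i j, i != j -> crs i j t != crs j i t).
  apply: generically_forall => i; apply: generically_forall => j.
  apply: generically_imply => ij.
  (* The difference of the two cross products, as a polynomial in t of degree 2. *)
  pose a := i.+1%:R^-1 : F; pose b := j.+1%:R^-1 : F.
  pose f (l : 'I_2) := if l == ord0
    then T.1 i i + a * T.2 j j - T.1 j j - b * T.2 i i else a - b.
  have f1 : f ord_max != 0.
    rewrite /f /= subr_eq0 (inj_eq invr_inj) eqr_nat eqSS; exact: ij.
  have [p p0 Pp] := generically_sum_neq0 (T.1 i i * T.2 j j - T.1 j j * T.2 i i) f1.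
  exists p => // t /Pp; rewrite big_ord_recl big_ord1 /f /= -[in X in _ -> X]subr_eq0.
  apply: contraNN => /eqP <-; rewrite /crs -/a -/b; apply/eqP; ring.
have [p p0 Pp] := generically_and gen_diag gen_root.
exists p => // t /Pp[diag_t root_t]; split=> /=.
- by move=> i j ji; rewrite !mxE utA // -val_eqE gtn_eqF //= addr0.
- by move=> i j ji; rewrite !mxE utB // -val_eqE gtn_eqF //= addr0.
- by rewrite !mxE eqxx /= addr0.
- by rewrite !mxE eqxx /= addr0.
- by move=> i ik; rewrite !mxE eqxx ik; apply: diag_t.
move=> i j ik jk ij; rewrite /diag_root !mxE !eqxx ik jk /=.
apply: contra_neq (root_t i j ij) => /eqP.
by rewrite !mulNr eqr_opp eqr_div ?diag_t // => /eqP.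
Qed.

Lemma shift_cross_generic T :
  separated_trig k T -> generically (fun s => generic_trig k (shift_cross T s)).
Proof.
move=> sT.
have cross_diag s i : (shift_cross T s).1 i i = T.1 i i.
  rewrite /= !mxE; case: (eqVneq i k) => [->|_]; rewrite ?ltnn addr0 //.
have root_eq s i : diag_root (shift_cross T s) i = diag_root T i.
  by rewrite /diag_root cross_diag.
pose E s := \matrix_(i, j) (if (j == k) && (i < k)%N then s ^+ i.+1 else
                            if (i == k) && (k < j)%N then s ^+ j.+1 else 0 : F).
have eval_eq s mu : pencil_eval (shift_cross T s) (Some mu) =
    pencil_eval T (Some mu) + E s by rewrite /= addrAC.
pose M i := pencil_eval T (Some (diag_root T i)).
have utM i : upper_trig (M i) by exact: (st_eval_upper sT (Some (diag_root T i))).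
have Mi i : i != k -> M i i i = 0.
  by move=> ik; apply/eqP; rewrite (st_eval_diag_eq0 sT).
(* The null vectors of the leading and trailing blocks of [M i] are independent
   of [s], because [E s] is zero on both blocks. *)
have gen_above : generically (fun s => forall i : 'I_n, (i < k)%N ->
    coupled_above k (M i + E s)).
  apply: generically_forall => i; apply: generically_imply => ik.
  pose S (j : 'I_n) := (j < k)%N.
  have [|w w0 [w_ge wM]] := @principal_kernel_row _ _ S _ i (utM i) ik.
    by rewrite Mi // neq_ltn ik.
  have {w0} [l wl] : exists l, w ord0 l != 0.
    apply/existsP; apply: contraNT w0 => /existsPn w0.
    by apply/eqP/rowP => l; rewrite [RHS]mxE; apply/eqP; rewrite -[_ == _]negbK w0.
  have [p p0 Pp] := generically_sum_neq0 ((w *m M i) ord0 k) wl.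
  exists p => // s /Pp nz; exists w; split.
  - by move=> j kj; apply: w_ge; rewrite /S -leqNgt.
  - move=> j jk; rewrite mulmxDr mxE wM // add0r mxE big1 // => a _.
    rewrite mxE -[j == k]val_eqE (ltn_eqF jk) (ltnNge k) (ltnW jk) andbF mulr0 //.
  - rewrite mulmxDr mxE [X in _ + X]mxE; congr (_ + _ != 0): nz.
    apply: eq_bigr => a _; rewrite mxE eqxx /= ltnn andbF.
    by case: ifPn => // /w_ge ->; rewrite !mul0r.
have gen_below : generically (fun s => forall i : 'I_n, (k < i)%N ->
    coupled_below k (M i + E s)).
  apply: generically_forall => i; apply: generically_imply => ki.
  pose S (j : 'I_n) := (k < j)%N.
  have [|z z0 [z_le Mz]] := @principal_kernel_col _ _ S _ i (utM i) ki.
    by rewrite Mi // neq_ltn ki orbT.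
  have {z0} [l zl] : exists l, z l ord0 != 0.
    apply/existsP; apply: contraNT z0 => /existsPn z0.
    by apply/eqP/colP => l; rewrite [RHS]mxE; apply/eqP; rewrite -[_ == _]negbK z0.
  have [p p0 Pp] :=
    @generically_sum_neq0 _ _ ((M i *m z) k ord0) (fun l => z l ord0) l zl.
  exists p => // s /Pp nz; exists z; split.
  - by move=> j jk; apply: z_le; rewrite /S -leqNgt.
  - move=> j kj; rewrite mulmxDl mxE Mz // add0r mxE big1 // => a _.
    rewrite mxE -[j == k]val_eqE (gtn_eqF kj) (ltnNge _ k) (ltnW kj) andbF mul0r //.
  - rewrite mulmxDl mxE [X in _ + X]mxE; congr (_ + _ != 0): nz.
    apply: eq_bigr => a _; rewrite mxE eqxx /= ltnn andbF mulrC.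
    by case: ifPn => // /z_le ->; rewrite !mulr0.
have [p p0 Pp] := generically_and gen_above gen_below.
exists p => // s /Pp[above below]; split.
- split=> [|||||i j ik jk ij].
  + move=> i j ji; rewrite !mxE (st_upper1 sT) // add0r.
    case: ifP => [/andP[/eqP jk ik]|_]; first by rewrite jk ltnNge (ltnW ik) in ji.
    case: ifP => [/andP[/eqP ik kj]|//]; by rewrite ik ltnNge (ltnW kj) in ji.
  + exact: (st_upper2 sT).
  + by rewrite cross_diag (st_k1 sT).
  + exact: (st_k2 sT).
  + exact: (st_diag sT).
  + by rewrite !root_eq (st_root sT).
- by move=> i ik; rewrite root_eq eval_eq; apply: above.
- by move=> i ki; rewrite root_eq eval_eq; apply: below.
Qed.

End Perturbation.

(** * Norm of the perturbation *)

Section Norm.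

Variable R : realType.
Local Notation C := (R[i]).

Lemma normc_leP (x : C) (d : R) :
  (ComplexField.Normc.normc x <= d) = (`|x| <= d%:C%C).
Proof. by rewrite -lecR. Qed.

Lemma frobenius_norm_sqr_le n (A : 'M[C]_n) (d : R) :
    (forall i j, `|A i j| <= d%:C%C) ->
  frobenius_norm A ^+ 2 <= (n%:R * d) ^+ 2.
Proof.
move=> Ad.
rewrite /frobenius_norm sqr_sqrtr; last first.
  by apply: sumr_ge0 => i _; apply: sumr_ge0 => j _; apply: sqr_ge0.
apply: (@le_trans _ _ (\sum_(i < n) \sum_(j < n) d ^+ 2)).
  apply: ler_sum => i _; apply: ler_sum => j _.
  have n0 : 0 <= ComplexField.Normc.normc (A i j).
    by case: (A i j) => a b; apply: sqrtr_ge0.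
  have nd : ComplexField.Normc.normc (A i j) <= d by rewrite normc_leP.
  by rewrite ler_pXn2r // nnegrE (le_trans n0).
by rewrite !sumr_const card_ord -mulrnA exprMn -natrX mulr_natl.
Qed.

Lemma pencil_norm_le n (P : pencil C n) (d : R) :
    0 <= d -> (forall i j, `|P.1 i j| <= d%:C%C) ->
    (forall i j, `|P.2 i j| <= d%:C%C) ->
  pencil_norm P <= 2 * n%:R * d.
Proof.
move=> d0 P1 P2; rewrite /pencil_norm.
have nd0 : 0 <= n%:R * d by rewrite mulr_ge0.
rewrite -mulrA -[leRHS]ger0_norm ?mulr_ge0 // -sqrtr_sqr ler_wsqrtr //.
apply: le_trans (lerD (frobenius_norm_sqr_le P1) (frobenius_norm_sqr_le P2)) _.
by have := sqr_ge0 (n%:R * d); lra.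
Qed.

End Norm.

Theorem theorem5p3 (R : realType) (n : nat) (k : 'I_n) (U : pencil R[i] n) :
  pencil_singular U ->
  pencil_upper_triangular U ->
  pencil_mx U k k = 0 ->
  forall eps : R, 0 < eps ->
  exists T : pencil R[i] n,
    (pencil_singular T /\ pencil_upper_triangular T) /\
    [/\ normal_rank T = n.-1,
        forall mu : option R[i], ~ pencil_eigenvalue T mu,
        forall i : 'I_n, pencil_mx T i i = 0 <-> i = k,
        is_right_minimal_index T k
      & pencil_norm (T - U) <= eps].
Proof.
move=> _ utU /pencil_mx_eq0[U1k U2k] eps eps0.
have utU1 : upper_trig U.1 by move=> i j /utU/pencil_mx_eq0[].
have utU2 : upper_trig U.2 by move=> i j /utU/pencil_mx_eq0[].
have n0 : 0 < n%:R :> R by rewrite ltr0n (leq_ltn_trans (leq0n k)).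
(* The bound 1 ensures that every power of [s] is at most [s]; the factor 4
   leaves room for entries of size [2 d] in both coefficient matrices. *)
pose d : R := Num.min 1 (eps / (4 * n%:R)).
have d0 : 0 < d by rewrite lt_min ltr01 divr_gt0 // mulr_gt0.
have [t /andP[t0 td] sep] :=
  generically_small (shift_diag_separated utU1 utU2 U1k U2k) d0.
have [s /andP[s0 sd] gT] := generically_small (shift_cross_generic sep) d0.
set T := shift_cross k _ _ in gT; exists T; split.
  by split; [apply: st_singular gT | apply: st_pencil_upper gT].
split; first exact: (st_normal_rank gT).
- exact: (gt_no_eigenvalue gT).
- exact: (st_pencil_diag gT).
- exact: (gt_right_minimal_index gT).
apply: (@le_trans _ _ (2 * n%:R * (d + d))); last first.
  have : d <= eps / (4 * n%:R) by rewrite ge_min lexx orbT.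
  rewrite ler_pdivlMr ?mulr_gt0 // => d_le; lra.
have C0 : 0 <= d%:C%C :> R[i] by rewrite ler0c ltW.
have t_le : `|t%:C%C| <= d%:C%C :> R[i] by rewrite ger0_norm ?ler0c ?lecR // ltW.
have s_le1 : `|s%:C%C| <= 1 :> R[i].
  rewrite ger0_norm ?ler0c ?(ltW s0) // -[1]/(1%:C%C) lecR (le_trans sd) //.
  by rewrite ge_min lexx.
have s_le : `|s%:C%C| <= d%:C%C :> R[i] by rewrite ger0_norm ?ler0c ?lecR // ltW.
have sX_le m : `|s%:C%C ^+ m.+1| <= d%:C%C :> R[i].
  rewrite normrX exprS (le_trans _ s_le) // ler_piMr ?normr_ge0 //.
  by rewrite exprn_ile1.
have inv_le m : `|t%:C%C * m.+1%:R^-1| <= d%:C%C :> R[i].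
  rewrite normrM (le_trans _ t_le) // ler_piMr // normfV normr_nat.
  by rewrite invf_le1 ?ltr0n // ler1n.
have dd : (d + d)%:C%C = d%:C%C + d%:C%C :> R[i] by rewrite rmorphD.
apply: pencil_norm_le; first by rewrite addr_ge0 // ltW.
  move=> i j; rewrite dd !mxE -(addrA (U.1 i j)) [U.1 i j + _]addrC addrK.
  rewrite (le_trans (ler_normD _ _)) // lerD //.
    by case: ifP; rewrite ?normr0.
  by case: ifP => _ //; case: ifP; rewrite ?normr0.
move=> i j; rewrite dd !mxE [U.2 i j + _]addrC addrK.
by rewrite (le_trans _ (_ : d%:C%C <= _)) ?lerDl //; case: ifP; rewrite ?normr0.
Qed.
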